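(* Let $G$ be a claw-free graph (i.e., $G$ contains no induced subgraph isomorphic to $K_{1,3}$) with no isolated vertices. Then \[ f_o(G)\ge \frac{|V(G)|}{\chi(G)}. \]
   Context: All graphs are finite and simple. An induced subgraph $H$ of a graph $G$ is called odd if every vertex of $H$ has odd degree in $H$. $f_o(G)$ denotes the maximum order of an odd induced subgraph of $G$. $\chi(G)$ denotes the chromatic number of $G$. *)

(* Defs.v *)
From mathcomp Require Import all_boot all_order all_algebra.
Set Implicit Arguments. Unset Strict Implicit. Unset Printing Implicit Defensive.

Definition simple_graph (T : finType) (e : rel T) : Prop :=
  symmetric e /\ irreflexive e.

Definition no_isolated (T : finType) (e : rel T) : Prop :=
  forall v : T, exists u : T, e v u.

Definition claw_free (T : finType) (e : rel T) : Prop :=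
  ~ exists v a b c : T,
      [/\ e v a, e v b, e v c &
       [/\ a != b, a != c, b != c &
        [/\ ~~ e a b, ~~ e a c & ~~ e b c]]].

Definition odd_induced (T : finType) (e : rel T) (S : {set T}) : bool :=
  [forall v in S, odd #|[set u in S | e v u]|].

Definition f_o (T : finType) (e : rel T) : nat :=
  \max_(S : {set T} | odd_induced e S) #|S|.

Definition colorable (T : finType) (e : rel T) (k : nat) : bool :=
  [exists c : {ffun T -> 'I_k}, [forall x, forall y, e x y ==> (c x != c y)]].

(* chi(G): least k admitting a proper k-colouring.  For loopless graphs a
   #|T|-colouring always exists, so searching 0..#|T| gives the minimum. *)
Definition chi (T : finType) (e : rel T) : nat :=
  find (colorable e) (iota 0 #|T|.+1).

(* Main.v *)
Require Import Defs.
From mathcomp Require Import all_boot all_order all_algebra.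
From mathcomp Require Import zify.
Import Order.TTheory GRing.Theory Num.Theory.

(* Work in one connected component [C] with a proper [k]-colouring, and let [I]
   be a maximal independent set of [C] containing a largest colour class. By
   claw-freeness every vertex outside [I] has one or two neighbours in [I].
   Suppose the vertices [q_1, ..., q_m] of [I] have neighbours [d_1, ..., d_m]
   outside [I] such that [d_i] sees none of [q_(i+1), ..., q_m]. Triangular
   elimination over F_2 then chooses sets [D] of [d]s and [J] of [q]s such that
   [D :|: J] is odd and has at least [m] vertices. Connectedness and
   claw-freeness order all of [I] but one vertex in this way, and all of [I] if
   some vertex outside has a single neighbour in [I].
   Hence only a deficit of one remains to be repaired, when every vertex outside
   has two neighbours in [I]. Then the other colour classes have at most [#|I|]
   vertices. If one of them has at most [#|I| - 2], counting suffices. Otherwise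
   one of them, after exchanging a single vertex if necessary, is an independent
   set dominating [I], and a minimal dominating subset together with private
   neighbours is an induced matching covering at least [#|I|] vertices. *)

(** * Parity and counting of neighbours inside a set *)

Definition nbrs {T : finType} (e : rel T) (A : {set T}) (x : T) : {set T} :=
  [set u in A | e x u].

Definition independent {T : finType} (e : rel T) (A : {set T}) : bool :=
  [forall x in A, forall y in A, ~~ e x y].

Lemma independentP (T : finType) (e : rel T) (A : {set T}) :
  reflect {in A &, forall x y, ~~ e x y} (independent e A).
Proof.
apply: (iffP forall_inP) => [h x y xA yA | h x xA].
  by move/forall_inP: (h x xA); apply.
by apply/forall_inP => y yA; apply: h.
Qed.

Lemma odd_nbrsU (T : finType) (e : rel T) (A B : {set T}) (x : T) :
  [disjoint A & B] ->
  odd #|nbrs e (A :|: B) x| = odd #|nbrs e A x| (+) odd #|nbrs e B x|.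
Proof.
move=> dAB; have -> : nbrs e (A :|: B) x = nbrs e A x :|: nbrs e B x.
  by apply/setP => u; rewrite !inE andb_orl.
rewrite cardsU -oddD; suff -> : nbrs e A x :&: nbrs e B x = set0.
  by rewrite cards0 subn0.
apply/setP => u; rewrite !inE; apply/negP => /andP[/andP[uA _] /andP[uB _]].
by move: (disjointFr dAB uA); rewrite uB.
Qed.

Lemma odd_nbrsU1 (T : finType) (e : rel T) (A : {set T}) (u x : T) :
  u \notin A -> odd #|nbrs e (u |: A) x| = e x u (+) odd #|nbrs e A x|.
Proof.
move=> uA; rewrite odd_nbrsU ?disjoints1 //; congr (_ (+) _).
case: (boolP (e x u)) => exu.
  suff -> : nbrs e [set u] x = [set u] by rewrite cards1.
  by apply/setP => v; rewrite !inE; case: eqP => // ->.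
suff -> : nbrs e [set u] x = set0 by rewrite cards0.
by apply/setP => v; rewrite !inE; case: eqP => // ->; apply: negbTE.
Qed.

Lemma double_count (T : finType) (e : rel T) (A B : {set T}) :
  symmetric e ->
  \sum_(x in A) #|nbrs e B x| = \sum_(y in B) #|nbrs e A y|.
Proof.
move=> se; under eq_bigr do rewrite -sum1_card.
under [RHS]eq_bigr do rewrite -sum1_card.
rewrite (exchange_big_dep (mem B)) /=; last by move=> x y _; rewrite inE => /andP[].
by apply: eq_bigr => y yB; apply: eq_bigl => x; rewrite !inE yB se.
Qed.

Lemma nbrs_independent_le2 (T : finType) (e : rel T) (I : {set T}) (v : T) :
  claw_free e -> independent e I -> #|nbrs e I v| <= 2.
Proof.
move=> cf /independentP iI; rewrite leqNgt; apply/negP => /card_gt2P.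
move=> [a [b [c [[]]]]]; rewrite !inE.
move=> /andP[aI va] /andP[bI vb] /andP[cI vc] [ab bc ca].
by case: cf; exists v, a, b, c; split => //; split; rewrite 1?[a == c]eq_sym //;
  split; apply: iI.
Qed.

(** * Induced matchings from dominating sets *)

(** In a minimal subset [D] of [D0] that still dominates [I], every vertex has a private neighbour
    in [I]. As [D] and [I] are independent, [D] and these neighbours induce a perfect matching. Each
    vertex of [D] sees at most two of [I], so [#|I| <= 2 * #|D|]. *)
Lemma induced_matching (T : finType) (e : rel T) (I D0 : {set T}) :
  simple_graph e -> claw_free e -> independent e I -> independent e D0 ->
  [disjoint D0 & I] -> {in I, forall q, exists2 d, d \in D0 & e d q} ->
  exists S : {set T}, [/\ S \subset D0 :|: I, odd_induced e S & #|I| <= #|S|].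
Proof.
move=> [se ie] cf iI /independentP iD0 dDI dom0.
pose dom (D : {set T}) := [forall q in I, [exists d in D, e d q]].
have : dom D0.
  by apply/forall_inP => q /dom0[d dD dq]; apply/exists_inP; exists d.
move=> /minset_exists[D /minsetP[/forall_inP domD minD] sD].
have iD : {in D &, forall x y, ~~ e x y}.
  by move=> x y xD yD; apply: iD0; apply: (subsetP sD).
pose private d q := [&& q \in I, e d q & [forall d' in D, e d' q ==> (d' == d)]].
have privD d : d \in D -> exists q, private d q.
  move=> dD; have : ~~ dom (D :\ d).
    apply/negP => h; have := minD _ h (subD1set _ _) => /setP/(_ d).
    by rewrite !inE eqxx dD.
  rewrite negb_forall_in => /exists_inP[q qI]; rewrite negb_exists_in.
  move=> /forall_inP h; exists q; rewrite /private qI /=.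
  have only d' : d' \in D -> e d' q -> d' == d.
    move=> d'D ed'; apply/eqP/eqP; apply: contraLR ed' => nd.
    by apply: h; rewrite !inE nd.
  case/exists_inP: (domD q qI) => d' d'D ed'.
  rewrite -{1}(eqP (only d' d'D ed')) ed' /=.
  by apply/forall_inP => d'' ?; apply/implyP; apply: only.
pose p d := odflt d [pick q | private d q].
have pP d : d \in D -> private d (p d).
  move=> /privD[q pq]; rewrite /p; case: pickP => [//|/(_ q)]; by rewrite pq.
have pI d : d \in D -> p d \in I by move=> /pP /and3P[].
have pe d : d \in D -> e d (p d) by move=> /pP /and3P[].
have pu d d' : d \in D -> d' \in D -> e d' (p d) -> d' = d.
  by move=> /pP /and3P[_ _ /forall_inP h] d'D /(implyP (h _ d'D)) /eqP.
have pinj : {in D &, injective p}.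
  by move=> d d' dD d'D epp; apply: pu => //; rewrite -epp; apply: pe.
exists (D :|: p @: D); split.
- apply/subUsetP; split; first exact: subset_trans sD (subsetUl _ _).
  apply: subset_trans (subsetUr _ _).
  by apply/subsetP => q /imsetP[d dD ->]; apply: pI.
- apply/forall_inP => x; rewrite inE => /orP[xD|/imsetP[d dD ->]].
    suff -> : [set u in D :|: p @: D | e x u] = [set p x] by rewrite cards1.
    apply/setP => u; rewrite !inE; apply/andP/eqP => [[]|->].
      case/orP => [uD xu|/imsetP[d dD ->] xu]; last by rewrite (pu d x).
      by move: (iD x u xD uD); rewrite xu.
    by rewrite pe // imset_f ?orbT.
  suff -> : [set u in D :|: p @: D | e (p d) u] = [set d] by rewrite cards1.
  apply/setP => u; rewrite !inE; apply/andP/eqP => [[]|->].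
    case/orP => [uD|/imsetP[d' d'D ->]]; first by rewrite se; apply: pu.
    by rewrite (negbTE (independentP _ _ _ iI _ _ (pI d dD) (pI d' d'D))).
  by rewrite dD se pe.
- have -> : #|D :|: p @: D| = 2 * #|D|.
    rewrite cardsU card_in_imset //; suff -> : D :&: p @: D = set0.
      by rewrite cards0 subn0 mul2n addnn.
    apply/setP => x; rewrite !inE; apply/negP => /andP[xD /imsetP[d dD xp]].
    by move: (disjointFr dDI (subsetP sD _ xD)); rewrite xp pI.
  rewrite -sum1_card; apply: (@leq_trans (\sum_(q in I) #|nbrs e D q|)).
    apply: leq_sum => q qI; apply/card_gt0P.
    by case/exists_inP: (domD q qI) => d dD dq; exists d; rewrite inE dD se.
  rewrite double_count // mulnC -sum_nat_const.
  by apply: leq_sum => d _; apply: nbrs_independent_le2.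
Qed.

(** * Triangular elimination over F_2 *)

(** The adjacency matrix with rows [d] and columns [q] is unitriangular, which forces the [q]s, and
    likewise the [d]s, to be distinct. Adjacency among the [d]s is unrestricted. *)
Fixpoint triangular {T : finType} (e : rel T) (s : seq (T * T)) : bool :=
  if s is (q, d) :: s' then
    [&& e d q, all (fun p => ~~ e d p.1) s' & triangular e s']
  else true.

Lemma triangular_edge (T : finType) (e : rel T) (s : seq (T * T)) (p : T * T) :
  triangular e s -> p \in s -> e p.2 p.1.
Proof.
elim: s => //= -[q d] s IH /and3P[dq _ /IH{}IH]; rewrite inE.
by case/orP => [/eqP->|/IH].
Qed.

(* Walking the list from its end decides which [d]s enter [D]; the [q]s are then
   decided from the front. At each pair either [d] is taken, or [q] is free and
   can be taken. *)
Lemma triangular_parity (T : finType) (e : rel T) (s : seq (T * T)) :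
  symmetric e -> triangular e s ->
  exists D : {set T},
    [/\ {subset D <= [seq p.2 | p <- s]},
        {in [seq p.1 | p <- s], forall q, odd #|nbrs e D q|}
      & forall g : T -> bool, exists J : {set T},
          [/\ {subset J <= [seq p.1 | p <- s]},
              {in D, forall d, odd #|nbrs e J d| = g d}
            & size s <= #|D| + #|J|]].
Proof.
move=> se; elim: s => [_|[q d] s IH].
  exists set0; split => [x|//|g]; first by rewrite inE.
  by exists set0; split => // x; rewrite inE.
move=> /= /and3P[dq /allP dN trs]; have [D [sD oD JD]] := IH trs.
have {}dN x : x \in [seq p.1 | p <- s] -> ~~ e d x.
  by move=> /mapP[p ps ->]; apply: dN.
have qs : q \notin [seq p.1 | p <- s] by apply/negP => /dN; rewrite dq.
have dD : d \notin D.
  apply/negP => /sD /mapP[p ps dp].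
  have := dN p.1 (map_f _ ps); rewrite dp.
  by rewrite (triangular_edge _ _ _ _ trs ps).
(* Taking [q] flips the parity at each neighbour of [q] in [D], hence the corrected target
   [e x q (+) g x]. In the resulting [J], [d] sees [q] alone. *)
have withq g : exists J : {set T},
   [/\ {subset J <= q :: [seq p.1 | p <- s]},
       {in D, forall x, odd #|nbrs e J x| = g x},
       odd #|nbrs e J d| & (size s).+1 <= #|D| + #|J|].
  have [J [sJ oJ szJ]] := JD (fun x => e x q (+) g x).
  have qJ : q \notin J by apply: contra qs; apply: sJ.
  exists (q |: J); split => [x|x xD||].
  - by rewrite !inE => /orP[->//|/sJ ->]; rewrite orbT.
  - by rewrite odd_nbrsU1 // oJ // addKb.
  - rewrite odd_nbrsU1 // dq; suff -> : nbrs e J d = set0 by rewrite cards0.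
    by apply/setP => x; rewrite !inE; apply/negP => /andP[/sJ/dN/negbTE->].
  - by rewrite cardsU1 qJ addnA addnAC addn1.
(* If [q] already has odd degree into [D], [d] stays out and [q] is the vertex gained. Otherwise [d]
   enters, which repairs [q] and does not affect the later [q]s; then [q] enters exactly when [g d]
   holds. *)
case: (boolP (odd #|nbrs e D q|)) => oq.
  exists D; split => [x /sD xs|x|g]; first by rewrite inE xs orbT.
    by rewrite inE => /orP[/eqP->|/oD].
  by have [J [? ? _ ?]] := withq g; exists J.
exists (d |: D); split => [x|x|g].
- by rewrite !inE => /orP[->//|/sD->]; rewrite orbT.
- rewrite inE odd_nbrsU1 // => /orP[/eqP->|xs].
    by rewrite se dq (negbTE oq).
  by rewrite se (negbTE (dN _ xs)) oD.
have [gd|gd] := boolP (g d).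
  have [J [sJ oJ oJd szJ]] := withq g; exists J; split => // [x|].
    by rewrite !inE => /orP[/eqP->|/oJ//]; rewrite oJd gd.
  by rewrite cardsU1 dD; lia.
have [J [sJ oJ szJ]] := JD g; exists J; split => [x /sJ xs|x|].
- by rewrite inE xs orbT.
- rewrite !inE => /orP[/eqP->|/oJ//]; rewrite (negbTE gd).
  suff -> : nbrs e J d = set0 by rewrite cards0.
  by apply/setP => y; rewrite !inE; apply/negP => /andP[/sJ/dN/negbTE->].
- by rewrite cardsU1 dD add1n addSn.
Qed.

(** A vertex of [J] has no neighbour in [J], so its parity comes from [D] alone. A vertex of [D]
    needs a parity into [J] opposite to its parity into [D]; this target depends on [D], which is
    why [triangular_parity] fixes [D] before [g]. *)
Lemma triangular_odd_induced (T : finType) (e : rel T) (I C : {set T})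
    (s : seq (T * T)) :
  symmetric e -> independent e I -> triangular e s -> I \subset C ->
  {subset [seq p.1 | p <- s] <= I} -> {subset [seq p.2 | p <- s] <= C :\: I} ->
  exists S : {set T}, [/\ S \subset C, odd_induced e S & size s <= #|S|].
Proof.
move=> se /independentP iI trs sIC sI sC.
have [D [sD oD JD]] := triangular_parity _ _ _ se trs.
have [J [sJ oJ szJ]] := JD (fun x => ~~ odd #|nbrs e D x|).
have dDJ : [disjoint D & J].
  rewrite -setI_eq0; apply/eqP/setP => x; rewrite !inE; apply/negP => /andP[].
  by move=> /sD/sC; rewrite inE => /andP[/negP nI _] /sJ/sI.
exists (D :|: J); split.
- apply/subsetP => x; rewrite inE => /orP[/sD/sC|/sJ/sI]; last exact: subsetP.
  by rewrite inE => /andP[].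
- apply/forall_inP => x xS; rewrite -[odd _]/(odd #|nbrs e (D :|: J) x|).
  rewrite odd_nbrsU //; case/setUP: xS => [xD|xJ].
    by rewrite oJ //; case: odd.
  rewrite oD ?sJ //; suff -> : nbrs e J x = set0 by rewrite cards0.
  apply/setP => y; rewrite !inE; apply/negP => /andP[yJ].
  by apply/negP/iI; apply/sI/sJ.
- rewrite cardsU; move: dDJ; rewrite -setI_eq0 => /eqP->.
  by rewrite cards0 subn0.
Qed.

(** * Ordering a dominating independent set of a connected component *)

Section Component.

Variables (T : finType) (e : rel T) (C I : {set T}).
Hypotheses (se : symmetric e) (ie : irreflexive e) (cf : claw_free e).
Hypothesis closedC : forall x y, e x y -> x \in C -> y \in C.
Hypothesis connC : {in C &, forall x y, connect e x y}.
Hypotheses (iI : independent e I) (sIC : I \subset C).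
Hypothesis domI : {in C :\: I, forall y, exists2 q, q \in I & e y q}.

Let nI : {in I &, forall x y, ~~ e x y}. Proof. exact/independentP. Qed.

(** If no pair qualified, each [d] outside [I] with a neighbour in [I :\: A] would have two there.
    Claw-freeness would then make [A] together with its neighbours closed under adjacency, against
    connectedness. *)
Lemma next_pair (A : {set T}) :
  A \proper I -> A != set0 ->
  exists q d, [/\ q \in I :\: A, d \in C :\: I, e d q
                & {in I :\: A, forall p, e d p -> p = q}].
Proof.
move=> /properP[sAI [q0 q0I q0A]] /set0Pn[a0 a0A].
pose good (p : T * T) :=
  [&& p.1 \in I :\: A, p.2 \in C :\: I, e p.2 p.1
    & [forall r in I :\: A, e p.2 r ==> (r == p.1)]].
case: (pickP good) => [[q d] /and4P[/= qI dC dq /forall_inP only]|none].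
  exists q, d; split => // p pI dp.
  by apply/eqP; move/implyP: (only p pI); apply.
have two d q : d \in C :\: I -> q \in I :\: A -> e d q ->
    exists p, [/\ p \in I :\: A, e d p & p != q].
  move=> dC qI dq; have := none (q, d); rewrite /good qI dC dq /=.
  move=> /negbT; rewrite negb_forall_in => /exists_inP[p pI].
  by rewrite negb_imply => /andP[dp pq]; exists p.
have split_nbrs d a q : d \in C :\: I -> a \in A -> e d a ->
    q \in I :\: A -> ~~ e d q.
  move=> dC aA da qI; apply/negP => dq.
  have [p [pI dp pq]] := two d q dC qI dq.
  case/setDP: qI => qI qA; case/setDP: pI => pI pA.
  have aI := subsetP sAI a aA.
  apply: cf; exists d, a, q, p; split => //; split; last by split; apply: nI.
  - by apply: contraNneq qA => <-.
  - by apply: contraNneq pA => <-.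
  - by rewrite eq_sym.
pose X := A :|: [set d in C :\: I | [exists a in A, e d a]].
have clX : closed e X.
  apply: intro_closed; first exact: sym_connect_sym.
  move=> x y xy; rewrite in_setU => /orP[xA|].
    have xI := subsetP sAI x xA.
    have yC : y \in C :\: I.
      rewrite inE (closedC _ _ xy (subsetP sIC _ xI)) andbT.
      by apply: contraL xy => yI; apply: nI.
    rewrite in_setU [in X in _ || X]inE yC /=; apply/orP; right.
    by apply/exists_inP; exists x => //; rewrite se.
  rewrite inE => /andP[xC /exists_inP[a aA xa]].
  have [yI|yI] := boolP (y \in I).
    rewrite in_setU; apply/orP; left; apply: contraLR xy => yA.
    by apply: (split_nbrs x a); rewrite // inE yA.
  have yC : y \in C :\: I.
    by rewrite inE yI (closedC _ _ xy) //; case/setDP: xC.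
  rewrite in_setU [in X in _ || X]inE yC /=; apply/orP; right.
  (* If [q] were outside [A], [y] would see [x], [q] and a second vertex [p] of [I :\: A]. Since [x]
     sees [a] in [A], it sees neither [q] nor [p]: a claw at [y]. *)
  case: (domI y yC) => q qI yq; apply/exists_inP; exists q => //.
  apply/negPn/negP => qA; have qIA : q \in I :\: A by rewrite inE qA.
  have [p [pIA yp pq]] := two y q yC qIA yq.
  have pI : p \in I by case/setDP: pIA.
  apply: cf; exists y, x, p, q; split => //; first by rewrite se.
  have xI : x \notin I by case/setDP: xC.
  split=> //; first by apply: contraNneq xI => ->.
    by apply: contraNneq xI => ->.
  by split; [apply: split_nbrs xa _ | apply: split_nbrs xa _ | apply: nI].
have := closed_connect clX (connC _ _ (subsetP sIC _ (subsetP sAI _ a0A))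
                                      (subsetP sIC _ q0I)).
by rewrite !in_setU a0A (negbTE q0A) /= inE inE q0I.
Qed.

(** Each new pair goes to the front and its [q] joins [A]; the later [q]s come from the rest of
    [I :\: A], where [d] sees nothing. *)
Lemma triangular_order (A : {set T}) :
  A \subset I -> A != set0 ->
  exists s, [/\ triangular e s, {subset [seq p.1 | p <- s] <= I :\: A},
                {subset [seq p.2 | p <- s] <= C :\: I} & size s = #|I :\: A|].
Proof.
move En : #|I :\: A| => n; elim: n => [|n IH] in A En *.
  by exists [::].
move=> sAI A0; have pAI : A \proper I.
  by rewrite properE sAI -setD_eq0 -cards_eq0 En.
have [q [d [qIA dC dq only]]] := next_pair A pAI A0.
have [qI qA] := setDP qIA.
have D1 : I :\: (q |: A) = (I :\: A) :\ q.
  by apply/setP => x; rewrite !inE negb_or andbA.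
have [||//|s [trs sI sC szs]] := IH (q |: A).
- by rewrite D1; have := cardsD1 q (I :\: A); rewrite qIA En => -[].
- by rewrite subUset sub1set qI.
- by apply/set0Pn; exists q; rewrite setU11.
have {}sI x : x \in [seq p.1 | p <- s] -> (x \in I :\: A) /\ x != q.
  by move/sI; rewrite D1 => /setD1P[].
exists ((q, d) :: s); split => /=.
- rewrite dq trs andbT /=; apply/allP => p ps.
  have [pI pq] := sI _ (map_f _ ps).
  by apply: contraNN pq => /(only _ pI) ->.
- by move=> x; rewrite inE => /orP[/eqP->//|/sI[]].
- by move=> x; rewrite inE => /orP[/eqP->//|/sC].
- by rewrite szs.
Qed.

(** The ordering must start from a nonempty [A]; a singleton costs only one vertex. *)
Lemma odd_induced_deficit1 :
  exists S : {set T}, [/\ S \subset C, odd_induced e S & #|I|.-1 <= #|S|].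
Proof.
have [->|/set0Pn[v vI]] := eqVneq I set0.
  exists set0; rewrite sub0set cards0; split => //.
  by apply/forall_inP => x; rewrite inE.
have [||s [trs sI sC szs]] := triangular_order [set v].
- by rewrite sub1set.
- by apply/set0Pn; exists v; rewrite set11.
have [|S [? ? szS]] := triangular_odd_induced _ _ _ _ _ se iI trs sIC _ sC.
  by move=> x /sI /setDP[].
exists S; split => //; apply: leq_trans szS.
by rewrite szs [#|I|](cardsD1 v) vI.
Qed.

(** The starting vertex [q] is not lost here: [d] sees nothing else of [I], so [(q, d)] can head the
    list. *)
Lemma odd_induced_pendant (d q : T) :
  d \in C :\: I -> nbrs e I d = [set q] ->
  exists S : {set T}, [/\ S \subset C, odd_induced e S & #|I| <= #|S|].
Proof.
move=> dC Nd; have /setIdP[qI dq] : q \in nbrs e I d by rewrite Nd set11.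
have [||s [trs sI sC szs]] := triangular_order [set q].
- by rewrite sub1set.
- by apply/set0Pn; exists q; rewrite set11.
have [|||S [? ? szS]] :=
  triangular_odd_induced _ _ _ C ((q, d) :: s) se iI _ sIC.
- rewrite /= dq trs andbT /=; apply/allP => p ps.
  have /setD1P[pq pI] := sI _ (map_f _ ps).
  by apply: contraNN pq => dp; rewrite -in_set1 -Nd inE pI.
- by move=> x; rewrite inE => /orP[/eqP->//|/sI /setDP[]].
- by move=> x; rewrite inE => /orP[/eqP->//|/sC].
exists S; split => //; apply: leq_trans szS.
by rewrite /= szs [#|I|](cardsD1 q) qI.
Qed.

(** * The case of exactly two neighbours in [I] for each outside vertex *)

Hypothesis no_pendant : {in C :\: I, forall d, #|nbrs e I d| = 2}.

Lemma card_two_nbrs (J : {set T}) :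
  J \subset C :\: I -> \sum_(q in I) #|nbrs e J q| = #|J| * 2.
Proof.
move=> sJ; rewrite double_count // -sum_nat_const.
by apply: eq_bigr => d /(subsetP sJ); apply: no_pendant.
Qed.

Lemma odd_induced_dominating (J : {set T}) :
  J \subset C :\: I -> independent e J ->
  {in I, forall q, exists2 d, d \in J & e d q} ->
  exists S : {set T}, [/\ S \subset C, odd_induced e S & #|I| <= #|S|].
Proof.
move=> sJ iJ domJ.
have dJI : [disjoint J & I].
  rewrite -setI_eq0; apply/eqP/setP => x; rewrite !inE; apply/negP.
  by case/andP => /(subsetP sJ) /setDP[_ /negP].
have [S [sS oS szS]] := induced_matching _ _ I J (conj se ie) cf iI iJ dJI domJ.
exists S; split => //; apply: subset_trans sS _.
by rewrite subUset sIC andbT (subset_trans sJ) ?subsetDl.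
Qed.

(** The [2 * #|J|] edges between [J] and [I] avoid [z], and every other vertex of [I] meets at most
    two of them. *)
Lemma card_nondominating (J : {set T}) (z : T) :
  J \subset C :\: I -> independent e J -> z \in I -> nbrs e J z = set0 ->
  #|J| < #|I|.
Proof.
move=> sJ iJ zI Nz; have := card_two_nbrs J sJ; rewrite (bigD1 z) //= Nz cards0.
move=> h; suff : #|J| * 2 <= #|I :\ z| * 2.
  by rewrite leq_pmul2r // [#|I|](cardsD1 z) zI add1n ltnS.
rewrite -h add0n -sum_nat_const (eq_bigl (mem (I :\ z))) => [|x]; last first.
  by rewrite !inE andbC.
by apply: leq_sum => x _; apply: nbrs_independent_le2.
Qed.

Hypothesis no_isol : no_isolated e.

(* If [J] has [#|I| - 1] vertices and misses [z], then [I :\ z] and [J] span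
   disjoint cycles. Putting a neighbour [w] of [z] into [J] evicts at most one
   vertex of [J], after which [J] dominates [I]. *)
Lemma odd_induced_near_dominating (J : {set T}) (z : T) :
  J \subset C :\: I -> independent e J -> z \in I -> nbrs e J z = set0 ->
  #|I| = #|J|.+1 ->
  exists S : {set T}, [/\ S \subset C, odd_induced e S & #|I| <= #|S|].
Proof.
move=> sJ iJ zI Nz IJ; have nJ := independentP _ _ _ iJ.
(* The edge count is now tight: [2 * #|J|] edges reach [#|J|] vertices of [I] other than [z], at
   most two each. *)
have two q : q \in I -> q != z -> #|nbrs e J q| = 2.
  move=> qI qz; apply/eqP; rewrite eqn_leq nbrs_independent_le2 //=.
  rewrite leqNgt; apply/negP => lt2.
  have := card_two_nbrs J sJ; rewrite (bigD1 z) //= Nz cards0 add0n.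
  rewrite (bigD1 q) ?qI //= => h.
  have : \sum_(i in I | (i != z) && (i != q)) #|nbrs e J i| <=
         #|I :\ z :\ q| * 2.
    rewrite -sum_nat_const (eq_bigl (mem (I :\ z :\ q))) => [|x]; last first.
      by rewrite !inE andbC -andbA andbCA.
    by apply: leq_sum => x _; apply: nbrs_independent_le2.
  have := cardsD1 q (I :\ z); rewrite !inE qz qI /=.
  have := cardsD1 z I; rewrite zI IJ /=.
  under eq_bigl do rewrite andbA.
  lia.
have [w zw] := no_isol z.
have wC : w \in C :\: I.
  rewrite inE (closedC _ _ zw (subsetP sIC _ zI)) andbT.
  by apply: contraL zw => wI; apply: nI.
have zJ y : y \in J -> ~~ e z y.
  move=> yJ; apply/negP => zy; have : y \in nbrs e J z by rewrite inE yJ.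
  by rewrite Nz inE.
have zNJ : z \notin J by apply/negP => /(subsetP sJ) /setDP[_]; rewrite zI.
have le1 : #|nbrs e J w| <= 1.
  rewrite leqNgt; apply/negP => /card_gt1P[x [y []]].
  rewrite !inE => /andP[xJ wx] /andP[yJ wy] xy.
  apply: cf; exists w, z, x, y; split => //; first by rewrite se.
  split => //; try by apply: contraNneq zNJ => ->.
  by split; [apply: zJ | apply: zJ | apply: nJ].
apply: (odd_induced_dominating (w |: (J :\: nbrs e J w))).
- by rewrite subUset sub1set wC (subset_trans _ sJ) ?subsetDl.
- have wJ x : x \in J :\: nbrs e J w -> ~~ e w x.
    by rewrite !inE => /andP[h xJ]; move: h; rewrite xJ.
  apply/independentP => x y /setU1P[->|xJ] /setU1P[->|yJ].
  + by rewrite ie.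
  + exact: wJ.
  + by rewrite se wJ.
  + by case/setDP: xJ => xJ _; case/setDP: yJ => yJ _; apply: nJ.
- move=> q qI; have [->|qz] := eqVneq q z.
    by exists w; rewrite ?setU11 // se.
  have : 0 < #|nbrs e J q :\: nbrs e J w|.
    rewrite cardsD two // subn_gt0; apply: leq_trans le1.
    by rewrite subset_leq_card ?subsetIr.
  case/card_gt0P => d /setDP[]; rewrite inE => /andP[dJ qd] dw.
  by exists d; [rewrite in_setU1 in_setD dJ dw orbT | rewrite se].
Qed.

End Component.

(** * Counting over colour classes in one component *)

Lemma card_colour_classes (T : finType) (k : nat) (c : T -> 'I_k) (A : {set T}) :
  #|A| = \sum_j #|[set x in A | c x == j]|.
Proof.
rewrite -sum1_card (partition_big c predT) //=; apply: eq_bigr => j _.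
by rewrite -sum1_card; apply: eq_bigl => x; rewrite inE.
Qed.

Lemma component_bound (T : finType) (e : rel T) (k : nat) (c : T -> 'I_k)
    (C : {set T}) :
  simple_graph e -> claw_free e -> no_isolated e ->
  (forall x y, e x y -> c x != c y) ->
  (forall x y, e x y -> x \in C -> y \in C) ->
  {in C &, forall x y, connect e x y} -> C != set0 ->
  exists S : {set T}, [/\ S \subset C, odd_induced e S & #|C| <= k * #|S|].
Proof.
move=> sg cf ni cP clC connC /set0Pn[x0 x0C]; have [se ie] := sg.
pose V j := [set x in C | c x == j].
pose i := [arg max_(j > c x0) #|V j|].
have maxi j : #|V j| <= #|V i| by rewrite /i; case: arg_maxnP => // m _; apply.
pose ind (A : {set T}) := (A \subset C) && independent e A.
have indV j (A : {set T}) : A \subset V j -> independent e A.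
  move=> sA; apply/independentP => x y /(subsetP sA) + /(subsetP sA).
  rewrite !inE => /andP[_ /eqP xj] /andP[_ /eqP yj].
  by apply/negP => /cP; rewrite xj yj eqxx.
have : ind (V i).
  rewrite /ind (indV i) // andbT.
  by apply/subsetP => x; rewrite inE => /andP[].
(* Maximality makes [I] dominate the rest of [C]. Containing the largest class [V i] bounds every
   other class by [#|I|] and leaves no vertex of colour [i] outside [I]. *)
move=> /maxset_exists[I /maxsetP[/andP[sIC iI] maxI] sVI].
have domI : {in C :\: I, forall y, exists2 q, q \in I & e y q}.
  move=> y /setDP[yC yI]; apply/exists_inP; apply: contraR yI.
  rewrite negb_exists_in => /forall_inP yn.
  suff <- : y |: I = I by rewrite setU11.
  apply: maxI; last exact: subsetUr.
  rewrite /ind subUset sub1set yC sIC /=; have nI := independentP _ _ _ iI.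
  apply/independentP => u v /setU1P[->|uI] /setU1P[->|vI].
  - by rewrite ie.
  - exact: yn.
  - by rewrite se yn.
  - exact: nI.
pose J j := [set x in C :\: I | c x == j].
have sJ j : J j \subset C :\: I by apply/subsetP => x; rewrite inE => /andP[].
have iJ j : independent e (J j).
  apply: (indV j); apply/subsetP => x; rewrite !inE.
  by case/andP => /andP[_ ->].
have J0 : J i = set0.
  apply/setP => x; rewrite !inE; apply/negP => /andP[/andP[xI xC] cx].
  by case/negP: xI; apply: (subsetP sVI); rewrite inE xC.
have cardC : #|C| = #|I| + \sum_(j | j != i) #|J j|.
  rewrite -(cardsID I C) (setIidPr sIC) (card_colour_classes _ _ c (C :\: I)).
  by rewrite (bigD1 i) //= -/(J i) J0 cards0.
have JI j : #|J j| <= #|I|.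
  apply: leq_trans (subset_leq_card sVI); apply: leq_trans (maxi j).
  by apply/subset_leq_card/subsetP => x; rewrite !inE => /andP[/andP[_ ->]].
have cardk : #|[pred j | j != i]|.+1 = k.
  by have := cardC1 i; rewrite card_ord => ->; case: (k) (i) => // -[].
have full (S : {set T}) : #|I| <= #|S| -> #|C| <= k * #|S|.
  move=> IS; apply: (@leq_trans (k * #|I|)); last by rewrite leq_mul2l IS orbT.
  have -> : k * #|I| = #|I| + #|[pred j | j != i]| * #|I|.
    by rewrite -mulSn cardk.
  rewrite cardC leq_add2l -sum_nat_const.
  by apply: leq_sum => j _.
have fullE : (exists S : {set T}, [/\ S \subset C, odd_induced e S & #|I| <= #|S|]) ->
    exists S : {set T}, [/\ S \subset C, odd_induced e S & #|C| <= k * #|S|].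
  by case=> S [? ? /full ?]; exists S.
have [/exists_inP[d dC /cards1P[q Nd]]|] :=
    boolP [exists d in C :\: I, #|nbrs e I d| == 1].
  by apply: fullE; apply: odd_induced_pendant Nd => //.
rewrite negb_exists_in => /forall_inP n1.
have two : {in C :\: I, forall d, #|nbrs e I d| = 2}.
  move=> d dC; have := nbrs_independent_le2 _ _ I d cf iI; have := n1 d dC.
  have : 0 < #|nbrs e I d|.
    by apply/card_gt0P; case: (domI d dC) => q qI dq; exists q; rewrite inE qI.
  by case: #|_| => [|[|[|]]].
have [/existsP[j /forall_inP dom]|] :=
    boolP [exists j, [forall q in I, [exists d in J j, e d q]]].
  apply: fullE; apply: (odd_induced_dominating _ _ C I) (sJ j) (iJ j) _ => //.
  by move=> q /dom /exists_inP.
rewrite negb_exists => /forallP ndom.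
have miss j : exists2 z, z \in I & nbrs e (J j) z = set0.
  have := ndom j; rewrite negb_forall_in => /exists_inP[z zI].
  rewrite negb_exists_in => /forall_inP h; exists z => //.
  apply/setP => x; rewrite [in LHS]inE [RHS]inE; apply/negP => /andP[/h + zx].
  by rewrite se zx.
have ltJ j : #|J j| < #|I|.
  by have [z zI Nz] := miss j; apply: (card_nondominating _ _ C I) Nz.
(* An edge at [x0] shows two colours, one of which differs from [i]. *)
have [j ji] : exists j, j != i.
  have [y xy] := ni x0; have xy' := cP _ _ xy.
  have [ci|] := eqVneq (c x0) i; last by exists (c x0).
  by exists (c y); rewrite -ci eq_sym.
have [lt2|] := ltnP #|J j|.+1 #|I|; last first.
  move=> ge1; have [z zI Nz] := miss j.
  apply: fullE; apply: (odd_induced_near_dominating _ _ C I) (iJ j) zI Nz _ => //.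
  by apply/eqP; rewrite eqn_leq ge1 ltJ.
have [S [sS oS szS]] := odd_induced_deficit1 _ _ _ _ se cf clC connC iI sIC domI.
exists S; split => //; apply: (@leq_trans (k * #|I|.-1)); last first.
  by rewrite leq_mul2l szS orbT.
(* Here [#|C|] is at most [#|I| + (#|I| - 2) + (k - 2) * (#|I| - 1)], that is [k * (#|I| - 1)]: the
   small class [J j] pays for the deficit. *)
rewrite cardC (bigD1 j) //=.
have : \sum_(m | (m != i) && (m != j)) #|J m| <=
       #|[pred m | (m != i) && (m != j)]| * #|I|.-1.
  rewrite -sum_nat_const; apply: leq_sum => m _.
  by rewrite -ltnS prednK ?ltJ // (leq_ltn_trans _ lt2).
have k2 : #|[pred m | (m != i) && (m != j)]|.+2 = k.
  rewrite -[RHS]cardk [in RHS](cardD1 j) inE ji add1n; congr _.+2.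
  by apply: eq_card => m; rewrite !inE andbC.
have -> : k * #|I|.-1 = #|[pred m | (m != i) && (m != j)]|.+2 * #|I|.-1.
  by rewrite k2.
rewrite !mulSn; move: (_ * #|I|.-1) => b sb.
by apply: leq_trans (leq_add (leqnn _) (leq_add (leqnn _) sb)) _; lia.
Qed.

(** * From components to the whole graph *)

(** A component [C] is split off [U]; no edge leaves it, so odd sets unite and the bounds add. The
    induction runs over closed sets of one fixed graph, so that its hypotheses and colouring never
    have to be restricted. *)
Lemma closed_set_bound (T : finType) (e : rel T) (k : nat) (c : T -> 'I_k)
    (U : {set T}) :
  simple_graph e -> claw_free e -> no_isolated e ->
  (forall x y, e x y -> c x != c y) ->
  (forall x y, e x y -> x \in U -> y \in U) ->
  exists S : {set T}, [/\ S \subset U, odd_induced e S & #|U| <= k * #|S|].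
Proof.
move=> sg cf ni cP; have [se ie] := sg.
have cs := sym_connect_sym se.
have [n] := ubnP #|U|; elim: n U => // n IH U ltUn clU.
have [->|/set0Pn[x xU]] := eqVneq U set0.
  exists set0; rewrite sub0set cards0; split => //.
  by apply/forall_inP => y; rewrite inE.
pose C := [set y | connect e x y].
have clC y z : e y z -> y \in C -> z \in C.
  by rewrite !inE => yz xy; apply: connect_trans xy (connect1 yz).
have xC : x \in C by rewrite inE connect0.
have closedU : closed e U by apply: intro_closed.
have sCU : C \subset U.
  by apply/subsetP => y; rewrite inE => /(closed_connect closedU) <-.
have [||S1 [sS1 oS1 szS1]] := component_bound _ _ _ c C sg cf ni cP clC.
- by move=> y z; rewrite !inE => xy; apply: connect_trans; rewrite cs.
- by apply/set0Pn; exists x.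
have [||S2 [sS2 oS2 szS2]] := IH (U :\: C).
- have := cardsID C U; rewrite (setIidPr sCU) => cU.
  have : 0 < #|C| by apply/card_gt0P; exists x.
  by lia.
- move=> y z yz /setDP[yU yC]; rewrite inE (clU _ _ yz yU) andbT.
  by apply: contra yC; apply: clC; rewrite se.
have dS : [disjoint S1 & S2].
  rewrite -setI_eq0; apply/eqP/setP => y; rewrite !inE; apply/negP => /andP[].
  by move=> /(subsetP sS1) yC /(subsetP sS2) /setDP[_ /negP].
exists (S1 :|: S2); split.
- rewrite subUset (subset_trans sS1 sCU) (subset_trans sS2) //.
  exact: subsetDl.
- have no12 y z : y \in S1 -> z \in S2 -> ~~ e y z.
    move=> /(subsetP sS1) yC /(subsetP sS2) /setDP[_].
    by apply: contra => /clC; apply.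
  apply/forall_inP => y /setUP[yS|yS].
    suff -> : [set u in S1 :|: S2 | e y u] = [set u in S1 | e y u].
      by apply: (forall_inP oS1).
    apply/setP => z; rewrite !inE; have [//|_] := boolP (z \in S1).
    by have [zS|//] := boolP (z \in S2); rewrite (negbTE (no12 y z yS zS)).
  suff -> : [set u in S1 :|: S2 | e y u] = [set u in S2 | e y u].
    by apply: (forall_inP oS2).
  apply/setP => z; rewrite !inE; have [zS|//] := boolP (z \in S1).
  by rewrite se (negbTE (no12 z y zS yS)) !andbF.
- rewrite cardsU; move: dS; rewrite -setI_eq0 => /eqP->.
  rewrite cards0 subn0 mulnDr -(cardsID C U) (setIidPr sCU).
  exact: leq_add.
Qed.

(** * The chromatic number and the final bound *)

Lemma colorable_chi (T : finType) (e : rel T) :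
  irreflexive e -> colorable e (chi e).
Proof.
move=> ie; have has_col : has (colorable e) (iota 0 #|T|.+1).
  apply/hasP; exists #|T|; first by rewrite mem_iota /= add0n.
  apply/existsP; exists [ffun x => enum_rank x].
  apply/forallP => x; apply/forallP => y; apply/implyP => xy; rewrite !ffunE.
  by apply: contraTneq xy => /enum_rank_inj ->; rewrite ie.
have := nth_find 0 has_col; rewrite nth_iota ?add0n //.
by rewrite has_find size_iota in has_col.
Qed.

Theorem theorem2p2 (T : finType) (e : rel T) :
  simple_graph e -> claw_free e -> no_isolated e ->
  ((#|T|%:R / (chi e)%:R : rat) <= (f_o e)%:R)%R.
Proof.
move=> sg cf ni; have [_ ie] := sg.
have /existsP[c /forallP cP] := colorable_chi T e ie.
have [||S [_ oS szS]] := closed_set_bound _ _ _ c [set: T] sg cf ni.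
- by move=> x y; move/forallP: (cP x) => /(_ y) /implyP; apply.
- by move=> x y _ _; rewrite inE.
have leS : #|S| <= f_o e by apply: (leq_bigmax_cond (F := fun S : {set T} => #|S|)).
(* Division by zero gives [0] in [rat], so the case [chi e = 0] is immediate. *)
have [->|chi0] := posnP (chi e); first by rewrite invr0 mulr0 ler0n.
rewrite ler_pdivrMr ?ltr0n // -natrM ler_nat -cardsT mulnC.
by apply: leq_trans szS _; rewrite leq_mul2l leS orbT.
Qed.
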